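(* Let $k$ be a field, let $a\ge 1$, let $R=k[x_1,\dots,x_a]$, and let $I=\langle p_1,p_2,\dots,p_r\rangle$ ($r\ge 1$) be the ideal generated by monomials $p_1,\dots,p_r\in R$. Let $M=R/I$, let $d_j=\deg(p_j)$, and for $i<j$ let $m_{ij}=\frac{\mathrm{lcm}(p_i,p_j)}{p_j}\in R$. Then for every integer $t\ge 0$, $$\mathrm{HF}(M,t)=F(a,t)-F(a,t-d_1)-\sum_{j=2}^{r}\mathrm{HF}\big(R/\langle m_{1j},m_{2j},\dots,m_{(j-1)j}\rangle,\;t-d_j\big).$$
   Context: Polynomial rings over $k$ are graded by total degree, and quotients by monomial ideals inherit this grading. For a graded module $M=\bigoplus_b M_b$, the Hilbert function is $\mathrm{HF}(M,b)=\dim_k M_b$, with $\mathrm{HF}(M,b)=0$ for $b<0$. $F(a,b)$ denotes the number of monomials of degree $b$ in $k[x_1,\dots,x_a]$ for $b\ge 0$, and $F(a,b)=0$ for $b<0$. *)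

(* Defs.v *)
From HB Require Import structures.
From mathcomp Require Import all_boot all_order all_algebra.
From mathcomp Require Import ring_quotient.
From mathcomp.multinomials Require Import mpoly.
(* Not imported: boolp's notations are incompatible with those of mpoly. *)
From mathcomp.classical Require boolp.
From Stdlib Require ClassicalEpsilon.

Set Implicit Arguments.
Unset Strict Implicit.
Unset Printing Implicit Defensive.

Import GRing.Theory.
Local Open Scope ring_scope.
Local Open Scope quotient_scope.

Section VectorSpaceDimension.

Variables (k : fieldType) (V : lmodType k).

Definition is_basis (S : V -> Prop) (n : nat) (v : 'I_n -> V) : Prop :=
  [/\ forall i, S (v i),
      forall c : 'I_n -> k, \sum_i c i *: v i = 0 -> forall i, c i = 0
    & forall x, S x -> exists c : 'I_n -> k, x = \sum_i c i *: v i].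

(* V need not be finite-dimensional, so vectType's \dim does not apply.  The
   value is arbitrary when the subspace S has no finite basis. *)
Definition dimk (S : V -> Prop) : nat :=
  ClassicalEpsilon.epsilon (inhabits 0%N)
    (fun n => exists v : 'I_n -> V, is_basis S v).

End VectorSpaceDimension.

Section MonomialIdeal.

Variables (k : fieldType) (a r : nat) (p : 'I_r -> 'X_{1..a}).

(* The case r = 0 gives the zero ideal; the ideal may also be the whole ring
   (when some p i is 0%MM), so it is not an idealr in general. *)
Definition mideal : {pred {mpoly k[a]}} := fun f =>
  boolp.asbool (exists q : 'I_r -> {mpoly k[a]}, f = \sum_i q i * 'X_[p i]).

Lemma mideal_closed : zmod_closed mideal.
Proof.
split=> [|f g /boolp.asboolP [q ->] /boolp.asboolP [s ->]]; apply/boolp.asboolP.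
  by exists (fun=> 0); rewrite big1 // => i _; rewrite mul0r.
exists (fun i => q i - s i); rewrite -sumrB.
by apply: eq_bigr => i _; rewrite mulrBl.
Qed.

HB.instance Definition _ :=
  GRing.isZmodClosed.Build {mpoly k[a]} mideal mideal_closed.

Local Notation quotI := (Quotient.quot (mideal : zmodClosed {mpoly k[a]})).

Definition mquot : Type := quotI.

HB.instance Definition _ := ZmodQuotient.copy mquot quotI.

(* For a possibly improper ideal, the library only makes the quotient an
   additive group; the k-vector space structure is added here. *)
Definition mquot_scale (c : k) (x : mquot) : mquot := \pi_mquot (c *: repr x).

Lemma mideal_scale c f : f \in mideal -> c *: f \in mideal.
Proof.
move=> /boolp.asboolP [q ->]; apply/boolp.asboolP; exists (fun i => c *: q i).
by rewrite scaler_sumr; apply: eq_bigr => i _; rewrite scalerAl.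
Qed.

Lemma pi_mquot_scale c f : \pi_mquot (c *: f) = mquot_scale c (\pi_mquot f).
Proof.
apply/eqP; rewrite -Quotient.idealrBE -scalerBr; apply: mideal_scale.
by rewrite Quotient.idealrBE reprK.
Qed.

Lemma mquot_scaleA b c x :
  mquot_scale b (mquot_scale c x) = mquot_scale (b * c) x.
Proof. by rewrite {2}/mquot_scale -pi_mquot_scale scalerA. Qed.

Lemma mquot_scale1 : left_id 1 mquot_scale.
Proof. by move=> x; rewrite /mquot_scale scale1r reprK. Qed.

Lemma mquot_scaleDr : right_distributive mquot_scale +%R.
Proof.
move=> c x y; rewrite -[x in LHS]reprK -[y in LHS]reprK -raddfD -pi_mquot_scale.
by rewrite scalerDr raddfD.
Qed.

Lemma mquot_scaleDl x : {morph mquot_scale^~ x : b c / b + c}.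
Proof. by move=> b c; rewrite /mquot_scale scalerDl raddfD. Qed.

HB.instance Definition _ := GRing.Zmodule_isLmodule.Build k mquot
  mquot_scaleA mquot_scale1 mquot_scaleDr mquot_scaleDl.

(* The degree b component of R / I is the image of that of R. *)
Definition mquot_piece (b : nat) (x : mquot) : Prop :=
  exists2 f : {mpoly k[a]}, f \is b.-homog & x = \pi_mquot f.

End MonomialIdeal.

(* The Hilbert function of R / I, where I is the ideal of R = k[x_1, .., x_a]
   generated by the monomials 'X_[p i]. *)
Definition HF (k : fieldType) (a r : nat) (p : 'I_r -> 'X_{1..a}) (b : int) : nat :=
  if b is Posz n then dimk (@mquot_piece k a r p n) else 0%N.

(* 'X_{1..a < n.+1} is the finite type of monomials of degree at most n. *)
Definition F (a : nat) (b : int) : nat :=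
  if b is Posz n then #|[set m : 'X_{1..a < n.+1} | mdeg m == n]| else 0%N.

(* lcm(p_i, p_j) / p_j for i < j; the subtraction is exact since p_j divides
   the lcm. *)
Definition mcolon (a r : nat) (p : 'I_r -> 'X_{1..a}) (j : 'I_r)
    (i : 'I_j) : 'X_{1..a} :=
  let pi := p (widen_ord (ltnW (ltn_ord j)) i) in (mlcm pi (p j) - p j)%MM.

Arguments mcolon {a r} p j i.

(* Main.v *)
Require Import Defs.
From mathcomp Require Import all_boot all_order all_algebra.
From mathcomp.multinomials Require Import mpoly.
From mathcomp Require Import ring_quotient zify.
From mathcomp.classical Require boolp.
From Stdlib Require ClassicalEpsilon.

(** Both sides count monomials.  Modulo a monomial ideal, the degree-n monomials
    divisible by no generator (the standard monomials) form a basis of the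
    degree-n piece of the quotient: a polynomial lies in the ideal exactly when
    each of its monomials is divisible by some generator ([mem_mideal]), so
    standard monomials stay independent and the others vanish.  Hence the
    Hilbert function is the number of standard monomials ([HF_count]).

    A monomial of degree t that is not standard is divisible by some p_j; sort
    these monomials by the least such index j ([size_monomials_split]).  Write a
    monomial of class j as p_j * m'.  No p_i with i < j divides it, which says
    that no m_ij = lcm(p_i, p_j) / p_j divides m'.  So division by p_j is a
    bijection from class j onto the monomials of degree t - d_j that are
    standard for the m_ij ([count_first_divisor]), and class j has
    HF(R / (m_1j, .., m_(j-1)j), t - d_j) elements ([HF_mcolon]).  For the first
    index there is no m_ij, so that class has F(a, t - d_1) elements. *)

Import GRing.Theory.
Local Open Scope ring_scope.
Local Open Scope quotient_scope.

(** * Invariance of dimension *)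

(** Writing the free family [v] in terms of [w] gives a coefficient matrix whose
    rows are independent, so it has at most as many rows as columns. *)
Lemma is_basis_leq {k : fieldType} {V : lmodType k} {S : V -> Prop}
    {m n : nat} {v : 'I_m -> V} {w : 'I_n -> V} :
  is_basis S v -> is_basis S w -> (m <= n)%N.
Proof.
move=> [Sv freev _] [_ _ genw].
have [C vE] := fin_all_exists (fun i => genw _ (Sv i)).
suff: row_free (\matrix_(i, j) C i j) by move/eqP <-; apply: rank_leq_col.
apply: inj_row_free => u uC0; apply/rowP=> i; rewrite mxE.
apply: freev i; transitivity (\sum_j \sum_i (u 0 i * C i j) *: w j).
  rewrite exchange_big; apply: eq_bigr => i _.
  by rewrite vE scaler_sumr; apply: eq_bigr => j _; rewrite scalerA.
rewrite big1 // => j _; rewrite -scaler_suml.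
have /rowP/(_ j) := uC0; rewrite !mxE => uC0j.
rewrite -[RHS](scale0r (w j)) -[in RHS]uC0j; congr (_ *: _).
by apply: eq_bigr => i _; rewrite mxE.
Qed.

Lemma dimk_basis (k : fieldType) (V : lmodType k) (S : V -> Prop) (n : nat)
    (v : 'I_n -> V) : is_basis S v -> dimk S = n.
Proof.
move=> bv; have := ClassicalEpsilon.epsilon_spec (inhabits 0%N)
  (fun n => exists v : 'I_n -> V, is_basis S v)
  (ex_intro _ n (ex_intro _ v bv)).
rewrite -/(dimk S) => -[w bw].
by apply/eqP; rewrite eqn_leq (is_basis_leq bw bv) (is_basis_leq bv bw).
Qed.

(** * Monomials of a given degree *)

Definition monomials (a n : nat) : seq 'X_{1..a} :=
  [seq m <- [seq bmnm m | m <- enum {: 'X_{1..a < n.+1}}] | mdeg m == n].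

Lemma mem_monomials a n m : (m \in monomials a n) = (mdeg m == n).
Proof.
rewrite mem_filter; case: eqP => //= degm.
have ltm : (mdeg m < n.+1)%N by rewrite degm.
by apply/mapP; exists (BMultinom ltm); rewrite ?mem_enum.
Qed.

Lemma uniq_monomials a n : uniq (monomials a n).
Proof.
by rewrite filter_uniq // map_inj_uniq ?enum_uniq //; apply: val_inj.
Qed.

Lemma F_size a n : F a (Posz n) = size (monomials a n).
Proof.
rewrite /F cardsE cardE /enum_mem /monomials !size_filter count_map enumT.
exact: eq_count.
Qed.

(** * The basis of standard monomials *)

Definition standard {a r : nat} (p : 'I_r -> 'X_{1..a}) (m : 'X_{1..a}) :=
  [forall i, ~~ (p i <= m)%MM].

(** The generators are monomials, so membership is decided monomial by monomial:
    every monomial of q * p_i is divisible by p_i, and conversely a monomial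
    divisible by p_i is a multiple of it. *)
Lemma mem_mideal (k : fieldType) (a r : nat) (p : 'I_r -> 'X_{1..a})
    (f : {mpoly k[a]}) :
  f \in mideal p <-> {in msupp f, forall m, ~~ standard p m}.
Proof.
split.
  move=> /boolp.asboolP [q ->] m; rewrite mcoeff_msupp => nz.
  apply/negP=> /forallP std; case/eqP: nz; rewrite raddf_sum /= big1 // => i _.
  apply/eqP; rewrite -[_ == _]negbK -mcoeff_msupp; apply/negP.
  rewrite (perm_mem (msuppMX _ _)) => /mapP[m' _ mE].
  by move/negP: (std i); apply; rewrite mE lem_addr.
move=> nstd; rewrite [f]mpolyE big_seq; apply: rpred_sum => m /nstd.
rewrite negb_forall => /existsP[i]; rewrite negbK => le_im.
apply: mideal_scale; apply/boolp.asboolP.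
(* The monomial m is (m / p_i) * p_i, with coefficient 0 on the other p_j. *)
exists (fun j => if j == i then 'X_[m - p i] else 0).
rewrite (bigD1 i) //= eqxx big1 ?addr0 => [|j /negPf->]; last by rewrite mul0r.
by rewrite -mpolyXD submK.
Qed.

(** The classes of the standard monomials [e i] of degree n are a basis of the
    degree-n piece: by [mem_mideal], a combination of them in the ideal has zero
    coefficients, and a homogeneous polynomial is congruent to its standard
    part. *)
Lemma HF_count (k : fieldType) (a r : nat) (p : 'I_r -> 'X_{1..a}) (n : nat) :
  HF k p (Posz n) = count (standard p) (monomials a n).
Proof.
rewrite -size_filter; set s := filter _ _.
have us : uniq s by rewrite filter_uniq ?uniq_monomials.
pose e (i : 'I_(size s)) := tnth (in_tuple s) i.
have e_inj : injective e by apply/tuple_uniqP.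
have sE m : m \in s -> exists i, m = e i by move/(tnthP (in_tuple s)).
have es i : e i \in s by apply: mem_tnth.
have piE (c : 'I_(size s) -> k) :
    \sum_i c i *: (\pi_(mquot k p) 'X_[e i] : mquot k p) =
    \pi_(mquot k p) (\sum_i c i *: 'X_[e i]).
  by rewrite raddf_sum; apply: eq_bigr => i _ /=; rewrite pi_mquot_scale.
have coefE (c : 'I_(size s) -> k) i : (\sum_i c i *: 'X_[e i])@_(e i) = c i.
  rewrite raddf_sum (bigD1 i) //= mcoeffZ mcoeffX eqxx mulr1.
  rewrite big1 ?addr0 // => j.
  by rewrite mcoeffZ mcoeffX inj_eq // => /negPf->; rewrite mulr0.
apply: (@dimk_basis _ _ _ _ (fun i => \pi_(mquot k p) 'X_[e i])); split.
- move=> i; exists 'X_[e i] => //; rewrite dhomogX.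
  by have := es i; rewrite mem_filter mem_monomials => /andP[].
- move=> c; rewrite piE => sum0 i; apply/eqP/negPn/negP => nz.
  have /mem_mideal/(_ (e i)) : \sum_i c i *: 'X_[e i] \in mideal (k := k) p.
    by rewrite -[X in X \in _]subr0 Quotient.idealrBE sum0 raddf0.
  rewrite mcoeff_msupp coefE => /(_ nz).
  by have := es i; rewrite mem_filter => /andP[->].
- move=> _ [f homf ->]; exists (fun i => f@_(e i)); rewrite piE.
  apply/eqP; rewrite -Quotient.idealrBE; apply/mem_mideal => m.
  rewrite mcoeff_msupp; apply: contraNN => stdm.
  have [/sE[i ->]|nsm] := boolP (m \in s); first by rewrite mcoeffB coefE subrr.
  have fm0 : f@_m = 0.
    apply/eqP; rewrite -[_ == _]negbK -mcoeff_msupp; apply: contra nsm => fm.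
    rewrite mem_filter stdm mem_monomials.
    by have /dhomogP/(_ m fm)/eqP := homf.
  rewrite mcoeffB fm0 sub0r raddf_sum big1 ?oppr0 // => i _ /=.
  rewrite mcoeffZ mcoeffX; case: eqP => [em|]; last by rewrite mulr0.
  by rewrite -em es in nsm.
Qed.

(** * Splitting the monomials by their first divisor *)

Definition first_divisor {a r : nat} (p : 'I_r -> 'X_{1..a}) (j : 'I_r)
    (m : 'X_{1..a}) : bool :=
  (p j <= m)%MM &&
  [forall i : 'I_j, ~~ (p (widen_ord (ltnW (ltn_ord j)) i) <= m)%MM].

(** A sum of booleans equal to 1 expresses that exactly one of these properties
    holds, in a form that can be summed over all monomials. *)
Lemma standard_first_divisor {a r : nat} (p : 'I_r -> 'X_{1..a}) m :
  (standard p m + \sum_j first_divisor p j m = 1)%N.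
Proof.
rewrite /standard; case: forallP => [std|nstd].
  by rewrite big1 // => j _; rewrite /first_divisor (negPf (std j)).
have [i0 le0] : exists i, (p i <= m)%MM.
  by apply/existsP; apply: contra_notT nstd; rewrite negb_exists => /forallP.
have [j lej minj] :=
  @arg_minnP _ i0 (fun i => p i <= m)%MM (fun i => val i) le0.
rewrite add0n (bigD1 j) //= big1 => [|i neij].
  rewrite /first_divisor lej addn0; case: forallP => // -[] i.
  by apply/negP => /minj /=; rewrite leqNgt ltn_ord.
rewrite /first_divisor; case: (boolP (p i <= m)%MM) => //= lei.
case: forallP => // nlt; have ltji : (j < i)%N.
  by rewrite ltn_neqAle minj // andbT eq_sym.
have /negP[] := nlt (Ordinal ltji).
by rewrite (_ : widen_ord _ _ = j) //; apply: val_inj.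
Qed.

Lemma size_monomials_split {a r : nat} (p : 'I_r -> 'X_{1..a}) n :
  size (monomials a n) =
  (count (standard p) (monomials a n) +
   \sum_j count (first_divisor p j) (monomials a n))%N.
Proof.
under eq_bigr do rewrite -sum1_count big_mkcond.
rewrite -sum1_count exchange_big big_mkcond -big_split /= -sum1_size.
apply: eq_bigr => m _; rewrite -[LHS](standard_first_divisor p m).
by congr (_ + _)%N; apply: eq_bigr => j _; case: first_divisor.
Qed.

(** Since [mcolon p j i] is lcm(p_i, p_j) / p_j, divisibility of [m] by it says
    that lcm(p_i, p_j), equivalently p_i, divides p_j * m. *)
Lemma mcolon_lem (a r : nat) (p : 'I_r -> 'X_{1..a}) (j : 'I_r) (i : 'I_j) m :
  (mcolon p j i <= m)%MM = (p (widen_ord (ltnW (ltn_ord j)) i) <= p j + m)%MM.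
Proof.
apply/mnm_lepP/mnm_lepP => le s; have := le s; rewrite !mnmE; lia.
Qed.

(** Multiplication by p_j is the bijection between the two sets of monomials. *)
Lemma count_first_divisor (a r : nat) (p : 'I_r -> 'X_{1..a}) (j : 'I_r) d :
  count (first_divisor p j) (monomials a (mdeg (p j) + d)) =
  count (standard (mcolon p j)) (monomials a d).
Proof.
rewrite -!size_filter -[RHS](size_map (fun m => p j + m)%MM).
apply/perm_size/uniq_perm.
- by rewrite filter_uniq ?uniq_monomials.
- by rewrite map_inj_uniq 1?filter_uniq ?uniq_monomials // => m1 m2 /addmI.
have stdE m : standard (mcolon p j) m = first_divisor p j (p j + m)%MM.
  rewrite /first_divisor lem_addr; apply: eq_forallb => i.
  by rewrite mcolon_lem.
move=> m; rewrite mem_filter mem_monomials; apply/andP/mapP.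
  move=> [fm /eqP dm]; have /andP[/submK mE _] := fm.
  have {}mE : m = (p j + (m - p j))%MM by rewrite addmC mE.
  exists (m - p j)%MM => //; rewrite mem_filter mem_monomials stdE -mE fm /=.
  by rewrite -(eqn_add2l (mdeg (p j))) -mdegD -mE dm.
move=> [m' + ->]; rewrite mem_filter mem_monomials stdE => /andP[-> /eqP <-].
by rewrite mdegD.
Qed.

Lemma HF_mcolon (k : fieldType) (a r : nat) (p : 'I_r -> 'X_{1..a}) (j : 'I_r)
    (n : nat) :
  HF k (mcolon p j) (n%:Z - (mdeg (p j))%:Z) =
  count (first_divisor p j) (monomials a n).
Proof.
have [le|lt] := leqP (mdeg (p j)) n.
  by rewrite subzn // HF_count -count_first_divisor subnKC.
(* In negative degree HF is 0, and p_j is too large to divide a monomial of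
   degree n. *)
have -> : (n%:Z - (mdeg (p j))%:Z) = Negz (mdeg (p j) - n).-1 by lia.
symmetry; apply/eqP; rewrite -leqn0 leqNgt -has_count; apply/hasPn => m.
rewrite mem_monomials => /eqP degm; apply/negP => /andP[/mnm_lepP le _].
by move: lt; rewrite -degm !mdegE ltnNge leq_sum.
Qed.

(** * The recursion for the Hilbert function *)

Lemma HF_zero_ideal (k : fieldType) {a : nat} (p : 'I_0 -> 'X_{1..a})
    (b : int) :
  HF k p b = F a b.
Proof.
case: b => // n; rewrite HF_count F_size -[RHS]count_predT.
apply: eq_count => m.
by apply/forallP => -[].
Qed.

Theorem theorem4p1 (k : fieldType) (a : nat) (ha : (1 <= a)%N)
  (r : nat) (hr : (1 <= r)%N) (p : 'I_r -> 'X_{1..a})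
  (t : int) (ht : 0 <= t) :
  (HF k p t)%:Z =
    (F a t)%:Z - (F a (t - (mdeg (p (Ordinal hr)))%:Z))%:Z
    - \sum_(j < r | (0 < j)%N) (HF k (mcolon p j) (t - (mdeg (p j))%:Z))%:Z.
Proof.
case: t ht => // n _.
(* The generators of the colon ideal at j = 0 form an empty family. *)
rewrite -[F a (_ - _)](HF_zero_ideal k (mcolon p (Ordinal hr))).
rewrite F_size HF_count (size_monomials_split p).
under [in X in X - _ - _]eq_bigr do rewrite -(HF_mcolon k).
have -> : \sum_(j < r | (0 < j)%N)
    (HF k (mcolon p j) (n%:Z - (mdeg (p j))%:Z))%:Z =
    (\sum_(j < r | j != Ordinal hr)
      HF k (mcolon p j) (n%:Z - (mdeg (p j))%:Z))%N%:Z.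
  rewrite (big_morph Posz PoszD erefl); apply: eq_bigl => j.
  by rewrite lt0n -val_eqE.
by rewrite (bigD1 (Ordinal hr)) //= -addrA -opprD -PoszD PoszD addrK.
Qed.
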